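(* Let $x$ be an indeterminate and $m,n$ positive integers with $m\ge n$. For $1\le k\le m$ put $a_k=\binom{m+k}{k}\binom{m}{k}\binom{n+k}{k}\binom{n}{k}$, $h_k=H^{(1)}_{m+k}+H^{(1)}_{m-k}+H^{(1)}_{n+k}+H^{(1)}_{n-k}-4H^{(1)}_k$ (for $k\le n$) and $b_k=\binom{m+k}{k}\binom{m}{k}\binom{n+k}{k}\big/\binom{k-1}{n}$ (for $n<k\le m$). Then, as rational functions of $x$, \[ \frac{x\,(1-x)_n(1-x)_m}{(x)_{n+1}(x)_{m+1}} = \frac1x + \sum_{k=1}^{n} a_k\left\{\frac{-k}{(x+k)^2}+\frac{1+k\,h_k}{x+k}\right\} + \sum_{k=n+1}^{m}\frac{(-1)^{k-n}\,b_k}{x+k}. \]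
   Context: $(a)_0=1$, $(a)_n=a(a+1)\cdots(a+n-1)$. Generalised harmonic sums: $H^{(i)}_n=\sum_{j=1}^n j^{-i}$ for $n\ge1$ and $H^{(i)}_0=0$. *)

(* Defs.v *)
From mathcomp Require Import all_boot all_order all_algebra.
Set Implicit Arguments.
Unset Strict Implicit.
Unset Printing Implicit Defensive.
Import GRing.Theory.
Local Open Scope ring_scope.

(* The field Q(x) of rational functions in one indeterminate. *)
Notation ratfun := {fraction {poly rat}}.

Definition indet : ratfun := @FracField.tofrac {poly rat} 'X.
Definition const (c : rat) : ratfun := @FracField.tofrac {poly rat} c%:P.

(* Rising factorial (a)_n = a (a + 1) ... (a + n - 1). *)
Definition poch (R : pzRingType) (a : R) (n : nat) : R :=
  \prod_(i < n) (a + i%:R).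

(* Generalised harmonic sum H^(i)_n. *)
Definition harm (i n : nat) : rat := \sum_(1 <= j < n.+1) j%:R ^- i.

Definition coef_a (m n k : nat) : nat :=
  ('C(m + k, k) * 'C(m, k) * 'C(n + k, k) * 'C(n, k))%N.

(* Used for 1 <= k <= n <= m, where the truncated m - k and n - k are exact. *)
Definition coef_h (m n k : nat) : rat :=
  harm 1 (m + k)%N + harm 1 (m - k)%N + harm 1 (n + k)%N + harm 1 (n - k)%N
  - 4%:R * harm 1 k.

(* Used for n < k <= m, where 'C(k.-1, n) is nonzero. *)
Definition coef_b (m n k : nat) : rat :=
  ('C(m + k, k) * 'C(m, k) * 'C(n + k, k))%N%:R / 'C(k.-1, n)%:R.

(* Main.v *)
(* Keep the factor [x] of the numerator uncancelled: the denominator is then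
   [\prod_(k <= m) (x + k) ^ e_k] with [e_k = 2] for [k <= n] and [e_k = 1]
   otherwise, and the term [1 / x] becomes the case [k = 0] of the first sum.
   Two polynomials of degree less than that of the denominator coincide as soon
   as they agree modulo each [(x + k) ^ e_k].  This local condition compares
   values and, for [k <= n], logarithmic derivatives at [- k]; the latter
   produce the harmonic sums. *)
Require Import Defs.
From mathcomp Require Import all_boot all_order all_algebra.
From mathcomp Require Import ring.
Import GRing.Theory.
Local Open Scope ring_scope.

(** * Partial fractions for pairwise coprime denominators *)

Lemma prod_dvdp_coprime (F : fieldType) (I : eqType) (s : seq I)
    (q : I -> {poly F}) (p : {poly F}) :
  uniq s -> (forall i j, i != j -> coprimep (q i) (q j)) ->
  (forall i, q i %| p) -> \prod_(i <- s) q i %| p.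
Proof.
move=> + q_coprime q_dvd; elim: s => [|i s IHs] /=; first by rewrite big_nil dvd1p.
case/andP=> i_notin_s s_uniq; rewrite big_cons Gauss_dvdp ?q_dvd ?IHs //.
rewrite big_seq_cond; elim/big_rec: _ => [|j p' /andP[j_in_s _] cop].
  exact: coprimep1.
rewrite coprimepMr cop andbT q_coprime //.
by apply: contraNneq i_notin_s => ->.
Qed.

(** Modulo [q i], only the [i]-th term of [\sum_i r i * c i] survives, since [q i] divides every
    other cofactor [c j]. So [p] minus this sum is divisible by the whole product. Taking the
    cofactors [c] as data lets them be explicit products later. *)
Lemma partial_fractions (F : fieldType) (I : finType) (q c r : I -> {poly F})
    (p : {poly F}) :
  (size p < size (\prod_i q i)%R)%N ->
  (forall i j, i != j -> coprimep (q i) (q j)) ->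
  (forall i, q i * c i = \prod_j q j) ->
  (forall i, size (r i) < size (q i))%N ->
  (forall i, q i %| p - r i * c i) ->
  FracField.tofrac p / FracField.tofrac (\prod_i q i) =
  \sum_i FracField.tofrac (r i) / FracField.tofrac (q i).
Proof.
set d := \prod_i q i => size_p q_coprime qc size_r q_dvd.
have d_neq0 : d != 0 by rewrite -size_poly_gt0 (leq_trans _ size_p).
have qc_neq0 i : (q i != 0) && (c i != 0) by rewrite -negb_or -mulf_eq0 qc.
have q_dvd_c i j : i != j -> q i %| c j.
  move=> i_neq_j; have/andP[qj_neq0 _] := qc_neq0 j.
  have -> : c j = \prod_(k | k != j) q k.
    by apply: (mulfI qj_neq0); rewrite qc /d (bigD1 j).
  by rewrite (bigD1 i) //= dvdp_mulr.
have p_eq : p = \sum_i r i * c i.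
  (* A nonzero multiple of [d] has size at least that of [d], whereas [p] and every [r i * c i] are
     shorter. *)
  apply/eqP; rewrite -subr_eq0; apply: contraTT size_p => diff_neq0.
  rewrite -leqNgt.
  have d_dvd : d %| p - \sum_i r i * c i.
    rewrite /d; apply: prod_dvdp_coprime => //; first exact: index_enum_uniq.
    move=> i; rewrite (bigD1 i) //= opprD addrA dvdp_subl //.
    by rewrite big_mkcond; elim/big_rec: _ => [|j u _ q_dvd_u] //;
      case: eqP => [|/eqP] //= ji; rewrite ?add0r // dvdp_addl // dvdp_mull // q_dvd_c // eq_sym.
  have := dvdp_leq diff_neq0 d_dvd; rewrite leqNgt; apply: contraNT.
  rewrite -ltnNge => size_p; apply: leq_ltn_trans (size_polyD _ _) _.
  rewrite gtn_max size_p size_polyN /=.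
  apply: leq_ltn_trans (size_sum _ _ _) _.
  rewrite -(@prednK (size d)) ?(leq_trans _ size_p) // ltnS.
  apply/bigmax_leqP => i _.
  have /andP[qi_neq0 ci_neq0] := qc_neq0 i.
  rewrite -(qc i) (size_mul qi_neq0 ci_neq0).
  apply: leq_trans (size_polyMleq _ _) _.
  have : (size (r i) + size (c i) < size (q i) + size (c i))%N by rewrite ltn_add2r.
  case: (size (q i) + size (c i))%N => // N; rewrite ltnS /= => le_N.
  by rewrite -!subn1 leq_sub2r.
rewrite [in LHS]p_eq rmorph_sum /= mulr_suml; apply: eq_bigr => i _.
have /andP[qi_neq0 ci_neq0] := qc_neq0 i.
by rewrite -(qc i) !rmorphM /= -mulf_div divff ?mulr1 // tofrac_eq0.
Qed.

(** * First-order jets and congruence modulo a squared linear factor *)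

(* [b] is the logarithmic derivative of [p] at [c] when [a != 0]. *)
Definition log_jet (F : fieldType) (c : F) (p : {poly F}) (a b : F) :=
  p.[c] = a /\ p^`().[c] = a * b.

Lemma log_jetM {F : fieldType} {c : F} {p q : {poly F}} {a b a' b' : F} :
  log_jet F c p a b -> log_jet F c q a' b' ->
  log_jet F c (p * q) (a * a') (b + b').
Proof.
move=> [pc dpc] [qc dqc]; split; first by rewrite hornerM pc qc.
by rewrite derivM hornerD !hornerM pc qc dpc dqc; ring.
Qed.

Lemma dvdp_XsubC_sqr (F : fieldType) (c : F) (p : {poly F}) :
  root p c -> root p^`() c -> ('X - c%:P) ^+ 2 %| p.
Proof.
case/factor_theorem => q ->; rewrite derivM derivXsubC mulr1 rootE hornerD.
rewrite hornerM hornerXsubC subrr mulr0 add0r -rootE => /factor_theorem[u ->].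
by rewrite -mulrA -expr2 dvdp_mull.
Qed.

(* If [e != 0], then [X u / v = a (c + (1 + c (b - b')) (X - c)) + O((X - c)^2)] at [c]. *)
Lemma dvdp_log_jet (F : fieldType) (c a e b b' : F) (u v : {poly F}) :
  log_jet F c u (a * e) b -> log_jet F c v e b' ->
  ('X - c%:P) ^+ 2 %|
    'X * u - a%:P * (c%:P + (1 + c * (b - b'))%:P * ('X - c%:P)) * v.
Proof.
move=> [uc duc] [vc dvc]; apply: dvdp_XsubC_sqr; rewrite rootE.
  by rewrite !(hornerD, hornerN, hornerM, hornerX, hornerC) uc vc; apply/eqP; ring.
rewrite derivB !(derivM, derivD, derivN, derivC, derivX).
rewrite ?(mul1r, mulr1, mul0r, add0r, oppr0, addr0).
rewrite !(hornerD, hornerN, hornerM, hornerX, hornerC) uc vc duc dvc.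
by apply/eqP; ring.
Qed.

(** * Jets of rising factorials at [- k] *)

Lemma pochS (R : pzRingType) (a : R) n : poch a n.+1 = poch a n * (a + n%:R).
Proof. by rewrite /poch big_ord_recr. Qed.

Lemma pochD (R : pzRingType) (a : R) m n :
  poch a (m + n) = poch a m * poch (a + m%:R) n.
Proof.
elim: n => [|n IHn]; first by rewrite addn0 /poch big_ord0 mulr1.
by rewrite addnS !pochS IHn -mulrA natrD addrA.
Qed.

Lemma harmS n : harm 1 n.+1 = harm 1 n + n.+1%:R^-1.
Proof. by rewrite /harm big_nat_recr //= expr1. Qed.

Lemma rat_nat_neq0 (n : nat) : (n.+1%:R : rat) != 0.
Proof. by rewrite Num.Theory.pnatr_eq0. Qed.

Lemma rat_fact_neq0 (n : nat) : ((n`!)%:R : rat) != 0.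
Proof. by rewrite Num.Theory.pnatr_eq0 -lt0n fact_gt0. Qed.

(** At [- k] the factor [1 - 'X + i] is [k + 1 + i] and has derivative [-1], so it contributes
    [- 1 / (k + 1 + i)] to the logarithmic derivative. *)
Lemma log_jet_poch_subX k n :
  log_jet rat (- k%:R) (poch (1 - 'X) n)
    ((n + k)`!%:R / k`!%:R) (harm 1 k - harm 1 (n + k)).
Proof.
elim: n => [|n IHn].
  split; rewrite /poch big_ord0 ?hornerC ?derivC ?horner0 add0n.
    by rewrite divff ?rat_fact_neq0.
  by rewrite subrr mulr0.
rewrite pochS; have -> : (n.+1 + k)`!%:R / k`!%:R =
   (n + k)`!%:R / k`!%:R * (n + k).+1%:R :> rat.
  by rewrite addSn factS natrM; field; rewrite rat_fact_neq0.
have -> : harm 1 k - harm 1 (n.+1 + k) =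
   harm 1 k - harm 1 (n + k) - (n + k).+1%:R^-1 by rewrite addSn harmS; ring.
apply: log_jetM IHn _; split.
  by rewrite !hornerE -?polyC_natr !hornerE -!natr1 natrD; ring.
by rewrite !derivE mul0rn sub0r addr0 !hornerE mulrN divff ?rat_nat_neq0.
Qed.

(** The factor ['X + i] is [- (k - i)] at [- k], nonzero because [i < j <= k]. It contributes one
    sign and the summand [- 1 / (k - i)]. *)
Lemma log_jet_pochX {k j} : (j <= k)%N ->
  log_jet rat (- k%:R) (poch 'X j)
    ((-1) ^+ j * k`!%:R / (k - j)`!%:R) (harm 1 (k - j) - harm 1 k).
Proof.
elim: j => [|j IHj] j_le_k.
  split; rewrite /poch big_ord0 ?hornerC ?derivC ?horner0 subn0.
    by rewrite expr0 mul1r divff ?rat_fact_neq0.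
  by rewrite subrr mulr0.
have kj : (k - j = (k - j.+1).+1)%N by rewrite subnSK.
move: (IHj (ltnW j_le_k)); rewrite kj pochS; set l := (k - j.+1)%N in kj * => IH.
have kE : k%:R = j%:R + l.+1%:R :> rat by rewrite -natrD -kj subnKC // ltnW.
have -> : (-1) ^+ j.+1 * k`!%:R / l`!%:R =
   (-1) ^+ j * k`!%:R / l.+1`!%:R * (- l.+1%:R) :> rat.
  by rewrite factS natrM exprS; field; rewrite rat_fact_neq0 nat1r rat_nat_neq0.
have -> : harm 1 l - harm 1 k = harm 1 l.+1 - harm 1 k - l.+1%:R^-1.
  by rewrite harmS; ring.
apply: log_jetM IH _; split.
  by rewrite -polyC_natr !hornerE kE; ring.
by rewrite -polyC_natr !derivE !hornerE mulrNN divff ?rat_nat_neq0.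
Qed.

Lemma log_jet_poch_above k j :
  log_jet rat (- k%:R) (poch ('X + k.+1%:R) j) j`!%:R (harm 1 j).
Proof.
elim: j => [|j IHj].
  split; rewrite /poch big_ord0 ?hornerC ?derivC ?horner0 //.
  by rewrite /harm big_geq ?mulr0.
rewrite pochS factS natrM [_.+1%:R * _]mulrC harmS; apply: log_jetM IHj _.
split; rewrite -!polyC_natr.
  by rewrite !hornerE -!natr1; ring.
by rewrite !derivE !hornerE divff ?rat_nat_neq0.
Qed.

(** The product is [poch 'X n.+1] without its factor ['X + k], the only one that vanishes at [- k].
    The sign comes from the [k] factors before the gap. *)
Lemma log_jet_poch_omit {k n} : (k <= n)%N ->
  log_jet rat (- k%:R) (poch 'X k * poch ('X + k.+1%:R) (n - k))
    ((-1) ^+ k * k`!%:R * (n - k)`!%:R) (harm 1 (n - k) - harm 1 k).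
Proof.
move=> k_le_n; have := log_jetM (log_jet_pochX (leqnn k))
   (log_jet_poch_above k (n - k)).
by rewrite subnn fact0 divr1 {1}/harm big_geq // sub0r [- _ + _]addrC.
Qed.

Lemma poch_omit {k n} : (k <= n)%N ->
  poch 'X n.+1 = ('X + k%:R) * (poch 'X k * poch ('X + k.+1%:R) (n - k)) :> {poly rat}.
Proof.
move=> k_le_n; have -> : n.+1 = (k.+1 + (n - k))%N by rewrite addSn subnKC.
by rewrite pochD pochS mulrCA mulrA.
Qed.

(** * The coefficients as quotients of factorials *)

Lemma bin_rat n k : (k <= n)%N ->
  'C(n, k)%:R = n`!%:R / (k`!%:R * (n - k)`!%:R) :> rat.
Proof.
by move=> k_le_n; rewrite -(bin_fact k_le_n) !natrM mulfK // mulf_neq0 ?rat_fact_neq0.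
Qed.

Lemma coef_aE m n k : (k <= n)%N -> (k <= m)%N ->
  (coef_a m n k)%:R = (m + k)`!%:R * (n + k)`!%:R /
    (k`!%:R ^+ 4 * (m - k)`!%:R * (n - k)`!%:R) :> rat.
Proof.
move=> kn km; rewrite /coef_a !natrM !bin_rat ?leq_addl // !addnK.
by field; rewrite !rat_fact_neq0.
Qed.

(** Dividing by ['C(k.-1, n)] cancels the [n]! of ['C(n + k, k)], brings in [(k - n.+1)]!, and
    leaves [k]! / [(k.-1)]!, which is the leading factor [k]. *)
Lemma coef_bE m n k : (n < k)%N -> (k <= m)%N ->
  coef_b m n k = k%:R * (m + k)`!%:R * (n + k)`!%:R * (k - n.+1)`!%:R /
    (k`!%:R ^+ 4 * (m - k)`!%:R).
Proof.
case: k => // k nk km; rewrite /coef_b !natrM !bin_rat ?leq_addl // !addnK subSS.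
rewrite [k.+1`!]factS natrM /=.
by field; rewrite ?nat1r ?rat_nat_neq0 ?rat_fact_neq0.
Qed.

(** * Roots and sizes of the factors *)

Lemma polyX_addn (R : nzRingType) (k : nat) : 'X + k%:R = 'X - (- k%:R)%:P :> {poly R}.
Proof. by rewrite polyCN opprK polyC_natr. Qed.

Lemma size_pochX (R : nzRingType) n : size (poch ('X : {poly R}) n) = n.+1.
Proof.
rewrite /poch; under eq_bigr do rewrite polyX_addn.
by rewrite -(big_mkord xpredT (fun i => 'X - (- i%:R)%:P)) size_prod_XsubC size_iota subn0.
Qed.

Lemma size_poch_subX (R : nzRingType) n :
  (size (poch (1 - 'X : {poly R}) n) <= n.+1)%N.
Proof.
elim: n => [|n IHn]; first by rewrite /poch big_ord0 size_poly1.
rewrite pochS; apply: leq_trans (size_polyMleq _ _) _.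
have -> : 1 - 'X + n%:R = - ('X - (n.+1%:R)%:P) :> {poly R}.
  by rewrite opprB polyC_natr -nat1r addrAC.
by rewrite size_polyN size_XsubC addn2.
Qed.

(** * Local conditions and decomposition of the given fraction *)

Section Decomposition.

Variables m n : nat.
Hypothesis n_le_m : (n <= m)%N.

Let p : {poly rat} := 'X * (poch (1 - 'X) n * poch (1 - 'X) m).
Let omit k l : {poly rat} := poch 'X k * poch ('X + k.+1%:R) (l - k).

Let q k : {poly rat} := ('X + k%:R) ^+ (k <= n).+1.
(** For [n < k] the factor ['X + k] does not occur in [poch 'X n.+1], which is therefore kept
    whole. *)
Let c k : {poly rat} := (if (k <= n)%N then omit k n else poch 'X n.+1) * omit k m.
(** For [k <= n] the simple and double poles at [- k] are put over the common denominator
    [('X + k) ^ 2]. At [k = 0] this gives ['X] over ['X ^ 2]. *)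
Let r k : {poly rat} :=
  if (k <= n)%N then
    (coef_a m n k)%:R%:P *
      ((- k%:R)%:P + (1 + k%:R * coef_h m n k)%:P * ('X + k%:R))
  else ((-1) ^+ (k - n) * coef_b m n k)%:P.

Lemma denominator_prod : \prod_(k < m.+1) q k = poch 'X n.+1 * poch 'X m.+1.
Proof.
rewrite /poch (big_ord_widen _ (fun i => 'X + i%:R) (n_le_m : (n < m.+1)%N)).
rewrite [X in _ = X * _]big_mkcond -big_split /=; apply: eq_bigr => k _.
by rewrite /q ltnS; case: leqP => _; rewrite ?expr1 ?mul1r ?expr2.
Qed.

Lemma denominator_cofactor k : (k <= m)%N -> q k * c k = poch 'X n.+1 * poch 'X m.+1.
Proof.
move=> k_le_m; rewrite /q /c (poch_omit k_le_m) -/(omit k m).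
case: leqP => [k_le_n|_]; last by rewrite expr1 mulrCA.
by rewrite (poch_omit k_le_n) -/(omit k n) expr2 mulrACA.
Qed.

Lemma dvdp_double k : (k <= n)%N -> q k %| p - r k * c k.
Proof.
move=> k_le_n; have k_le_m := leq_trans k_le_n n_le_m.
have jet_p := log_jetM (log_jet_poch_subX k n) (log_jet_poch_subX k m).
have jet_c := log_jetM (log_jet_poch_omit k_le_n) (log_jet_poch_omit k_le_m).
rewrite /q /p /r /c k_le_n polyX_addn.
have sgn : (-1) ^+ k * (-1) ^+ k = 1 :> rat by rewrite -expr2 sqrr_sign.
(* The ratio of the values at [- k] of the numerator (without its factor ['X]) and of the cofactor
   is exactly [a_k]; the two signs of the cofactor cancel. *)
have aE : (n + k)`!%:R / k`!%:R * ((m + k)`!%:R / k`!%:R) = (coef_a m n k)%:R *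
    ((-1) ^+ k * k`!%:R * (n - k)`!%:R * ((-1) ^+ k * k`!%:R * (m - k)`!%:R)) :> rat.
  rewrite coef_aE // [RHS](_ : _ = ((-1) ^+ k * (-1) ^+ k) *
    ((m + k)`!%:R * (n + k)`!%:R / (k`!%:R ^+ 2))).
    by rewrite sgn; field; rewrite rat_fact_neq0.
  by field; rewrite !rat_fact_neq0.
rewrite {}aE in jet_p.
(* The difference of the logarithmic derivatives is [- coef_h m n k], and the point [- k] supplies
   the other sign. *)
have -> : k%:R * coef_h m n k = - k%:R *
    (harm 1 k - harm 1 (n + k) + (harm 1 k - harm 1 (m + k)) -
     (harm 1 (n - k) - harm 1 k + (harm 1 (m - k) - harm 1 k))).
  by rewrite /coef_h; ring.
exact: dvdp_log_jet jet_p jet_c.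
Qed.

(** The factor ['X + k] occurs only once in the denominator, so equality of values at [- k] suffices
    and the derivative halves of the jets are dropped. *)
Lemma dvdp_simple k : (n < k)%N -> (k <= m)%N -> q k %| p - r k * c k.
Proof.
move=> n_lt_k k_le_m.
have [pa _] := log_jetM (log_jet_poch_subX k n) (log_jet_poch_subX k m).
have [ca _] := log_jetM (log_jet_pochX n_lt_k) (log_jet_poch_omit k_le_m).
rewrite /q /p /r /c leqNgt n_lt_k /= expr1 polyX_addn dvdp_XsubCl rootE.
rewrite hornerD hornerN !(hornerM 'X) hornerX pa hornerM ca hornerC coef_bE //.
(* The exponents add up to an odd number; the resulting [-1] matches the value [- k] of the factor
   ['X] of the numerator. *)
have sgn : (-1) ^+ (k - n) * ((-1) ^+ n.+1 * (-1) ^+ k) = -1 :> rat.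
  rewrite -!exprD -signr_odd !oddD oddB ?(ltnW n_lt_k) //=.
  by case: (odd k); case: (odd n).
apply/eqP; rewrite [X in _ - X](_ : _ = ((-1) ^+ (k - n) * ((-1) ^+ n.+1 * (-1) ^+ k)) *
   (k%:R * (m + k)`!%:R * (n + k)`!%:R / k`!%:R ^+ 2)).
  by rewrite sgn; field; rewrite rat_fact_neq0.
by field; rewrite !rat_fact_neq0.
Qed.

Lemma decomposition :
  FracField.tofrac p / FracField.tofrac (poch 'X n.+1 * poch 'X m.+1) =
  \sum_(k < m.+1) FracField.tofrac (r k) / FracField.tofrac (q k).
Proof.
have pochX_neq0 l : poch ('X : {poly rat}) l != 0.
  by rewrite -size_poly_gt0 size_pochX.
rewrite -denominator_prod.
apply: (@partial_fractions _ 'I_m.+1 (fun k => q k) (fun k => c k) (fun k => r k)).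
(* The numerator has degree at most [n + m + 1], the denominator [n + m + 2]. *)
- rewrite denominator_prod [X in (_ < X)%N]size_mul // !size_pochX addnS addSn.
  apply: leq_ltn_trans (size_polyMleq _ _) _; rewrite size_polyX add2n !ltnS.
  apply: leq_trans (size_polyMleq _ _) _.
  have := leq_add (size_poch_subX rat n) (size_poch_subX rat m).
  by case: (_ + _)%N => // l; rewrite addSn.
- move=> i j i_neq_j; rewrite /q coprimep_expl ?coprimep_expr // !polyX_addn.
  apply: coprimep_XsubC2; rewrite opprK addrC subr_eq0.
  by rewrite Num.Theory.eqr_nat.
- by move=> k; rewrite denominator_prod denominator_cofactor // -ltnS.
- move=> k; rewrite /q /r; case: (leqP k n) => _; last first.
    by rewrite expr1 polyX_addn size_XsubC ltnS size_polyC leq_b1.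
  rewrite polyX_addn size_exp_XsubC ltnS !mul_polyC.
  apply: leq_trans (size_scale_leq _ _) (leq_trans (size_polyD _ _) _).
  rewrite geq_max (leq_trans (size_polyC_leq1 _)) //=.
  by apply: leq_trans (size_scale_leq _ _) _; rewrite size_XsubC.
- move=> k; case: (leqP k n) => [/dvdp_double //|/dvdp_simple-> //].
  by rewrite -ltnS.
Qed.

(** * Passage to the field of rational functions *)

Lemma tofrac_addXn k : FracField.tofrac ('X + k%:R : {poly rat}) = indet + k%:R.
Proof. by rewrite rmorphD rmorph_nat. Qed.

Lemma indet_addn_neq0 k : indet + k%:R != 0.
Proof. by rewrite -tofrac_addXn tofrac_eq0 polyX_addn polyXsubC_eq0. Qed.

Lemma tofrac_double k : (k <= n)%N ->
  FracField.tofrac (r k) / FracField.tofrac (q k) =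
  (coef_a m n k)%:R * (- k%:R / (indet + k%:R) ^+ 2 +
    (1 + k%:R * const (coef_h m n k)) / (indet + k%:R)).
Proof.
move=> k_le_n; rewrite /r /q k_le_n; move: (coef_a _ _ _) (coef_h _ _ _) => a h.
rewrite !(polyCD, polyCM, polyCN, polyC_natr) polyC1.
rewrite !(rmorphD, rmorphM, rmorphN, rmorphXn, rmorph_nat, rmorph1) /=.
(* Stated over an abstract field, so that [field] meets variables instead of fractions of
   polynomials. *)
have split_sqr (K : fieldType) (b t u y : K) : y != 0 ->
    b * (- t + (1 + t * u) * y) / y ^+ 2 = b * (- t / y ^+ 2 + (1 + t * u) / y).
  by move=> y_neq0; field.
exact: split_sqr (indet_addn_neq0 k).
Qed.

Lemma tofrac_simple k : (n < k)%N ->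
  FracField.tofrac (r k) / FracField.tofrac (q k) =
  (-1) ^+ (k - n) * const (coef_b m n k) / (indet + k%:R).
Proof.
move=> n_lt_k; rewrite /r /q leqNgt n_lt_k /= expr1 tofrac_addXn.
by rewrite polyCM rmorph_sign rmorphM rmorph_sign.
Qed.

Lemma decomposition_indet :
  FracField.tofrac p / FracField.tofrac (poch 'X n.+1 * poch 'X m.+1) =
  1 / indet
  + \sum_(1 <= k < n.+1)
      (coef_a m n k)%:R *
        (- k%:R / (indet + k%:R) ^+ 2
         + (1 + k%:R * const (coef_h m n k)) / (indet + k%:R))
  + \sum_(n.+1 <= k < m.+1)
      (-1) ^+ (k - n)%N * const (coef_b m n k) / (indet + k%:R).
Proof.
rewrite decomposition.
rewrite -(big_mkord xpredT (fun k => FracField.tofrac (r k) / FracField.tofrac (q k))).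
rewrite (big_cat_nat (n := n.+1)) //=; congr (_ + _); last first.
  by apply: eq_big_nat => k /andP[n_lt_k _]; rewrite tofrac_simple.
rewrite big_ltn //; congr (_ + _); last first.
  by apply: eq_big_nat => k /andP[_ k_le_n]; rewrite tofrac_double.
(* At [k = 0] the coefficient [a_0] is 1, the double pole has coefficient 0 and the harmonic term is
   multiplied by 0, which leaves [1 / indet]. *)
by rewrite tofrac_double // /coef_a !bin0 !muln1 mulr0n !mul1r oppr0 !mul0r !addr0 add0r mul1r.
Qed.

End Decomposition.

Theorem theorem3p1 (m n : nat) (hm : (0 < m)%N) (hn : (0 < n)%N)
    (hnm : (n <= m)%N) :
  let x : ratfun := indet in
  x * poch (1 - x) n * poch (1 - x) m / (poch x n.+1 * poch x m.+1)
  = 1 / x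
    + \sum_(1 <= k < n.+1)
        (coef_a m n k)%:R *
          (- k%:R / (x + k%:R) ^+ 2
           + (1 + k%:R * const (coef_h m n k)) / (x + k%:R))
    + \sum_(n.+1 <= k < m.+1)
        (-1) ^+ (k - n)%N * const (coef_b m n k) / (x + k%:R).
Proof.
move=> x.
have tofrac_poch (a : {poly rat}) l :
    FracField.tofrac (poch a l) = poch (FracField.tofrac a) l.
  by rewrite /poch rmorph_prod; apply: eq_bigr => i _; rewrite rmorphD rmorph_nat.
rewrite -decomposition_indet // !rmorphM /= !tofrac_poch rmorphB rmorph1 -/x.
by rewrite mulrA.
Qed.
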